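(* For every $n\ge1$, $$\sum_{\sigma\in D_n}q^{\operatorname{dden}(\sigma)}t^{\operatorname{dexc}(\sigma)}=\sum_{\sigma\in D_n}q^{\operatorname{dmaj}(\sigma)}t^{\operatorname{ddes}(\sigma)}.$$
   Context: $B_n$ is the group of signed permutations: bijections $\sigma$ of $\{-n,\dots,n\}$ with $\sigma(-i)=-\sigma(i)$, written in window notation $\sigma(1)\cdots\sigma(n)$; $D_n=\{\sigma\in B_n:|\{i\in[n]:\sigma(i)<0\}|\text{ is even}\}$. Using the usual integer order, $\operatorname{Des}(\sigma)=\{i\in[n-1]:\sigma(i)>\sigma(i+1)\}$, $\operatorname{des}(\sigma)=|\operatorname{Des}(\sigma)|$, $\operatorname{maj}(\sigma)=\sum_{i\in\operatorname{Des}(\sigma)}i$. For $\sigma\in D_n$: $\operatorname{DNeg}(\sigma)=\{i\in[n]:\sigma(i)<-1\}$, $\operatorname{dneg}(\sigma)=|\operatorname{DNeg}(\sigma)|$, $\operatorname{ddes}(\sigma)=\operatorname{des}(\sigma)+\operatorname{dneg}(\sigma)$, $\operatorname{dmaj}(\sigma)=\operatorname{maj}(\sigma)-\sum_{i\in\operatorname{DNeg}(\sigma)}\sigma(i)-\operatorname{dneg}(\sigma)$. Let $|\sigma|=|\sigma(1)|\cdots|\sigma(n)|\in S_n$. For $\pi\in S_n$ (as a word $\pi_1\cdots\pi_n$): $\operatorname{Exc}(\pi)=\{i:\pi_i>i\}$, $\operatorname{exc}(\pi)=|\operatorname{Exc}(\pi)|$; $E(\pi)$ (resp. $N(\pi)$)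 is the subword of letters in positions in $\operatorname{Exc}(\pi)$ (resp. not in $\operatorname{Exc}(\pi)$), in increasing order of position; for a word $u$, $\operatorname{inv}(u)=|\{(i,j):i<j,u_i>u_j\}|$, $\operatorname{imv}(u)=|\{(i,j):i<j,u_i\ge u_j\}|$; $\operatorname{den}_H(\pi)=\sum_{i\in\operatorname{Exc}(\pi)}i+\operatorname{imv}(E(\pi))+\operatorname{inv}(N(\pi))$. Define $\operatorname{dexc}(\sigma)=\operatorname{exc}(|\sigma|)+\operatorname{dneg}(\sigma)$ and $\operatorname{dden}(\sigma)=\operatorname{den}_H(|\sigma|)-\sum_{i\in\operatorname{DNeg}(\sigma)}\sigma(i)-\operatorname{dneg}(\sigma)$. *)

(* Defs.v *)
From mathcomp Require Import all_boot all_order all_algebra all_fingroup.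

Set Implicit Arguments.
Unset Strict Implicit.
Unset Printing Implicit Defensive.

Import Order.TTheory GRing.Theory Num.Theory.
Local Open Scope ring_scope.

(* The set {-n, ..., n} is represented by 'I_(2n+1), the ordinal k standing   *)
(* for the integer k - n; negation is then rev_ord.                           *)
Definition sval n (k : 'I_n.*2.+1) : int := (k : nat)%:Z - n%:Z.

Lemma sval_rev n (k : 'I_n.*2.+1) : sval (rev_ord k) = - sval k.
Proof.
case: k => k; rewrite /sval /= ltnS subSS => lek.
by rewrite -(subzn lek) opprB -addnn PoszD addrAC addrK.
Qed.

Definition B n : {set {perm 'I_n.*2.+1}} :=
  [set s : {perm 'I_n.*2.+1} | [forall k, s (rev_ord k) == rev_ord (s k)]].

(* sapp s i is the integer s(i); meaningful for i <= n. *)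
Definition sapp n (s : {perm 'I_n.*2.+1}) (i : nat) : int :=
  sval (s (inord (n + i))).

Definition window n (s : {perm 'I_n.*2.+1}) : seq int :=
  [seq sapp s i | i <- iota 1 n].

Definition D n : {set {perm 'I_n.*2.+1}} :=
  [set s in B n | ~~ odd (count (fun i => sapp s i < 0) (iota 1 n))].

(* Words are sequences; positions are numbered from 1, and sets of positions  *)
(* are given by their increasing enumeration.                                 *)

Definition letter (T : nmodType) (w : seq T) (i : nat) : T := nth 0 w i.-1.

Definition Des (w : seq int) : seq nat :=
  [seq i <- iota 1 (size w).-1 | letter w i > letter w i.+1].
Definition des (w : seq int) : nat := size (Des w).
Definition maj (w : seq int) : nat := (\sum_(i <- Des w) i)%N.

Definition Exc (w : seq nat) : seq nat :=
  [seq i <- iota 1 (size w) | (letter w i > i)%N].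
Definition exc (w : seq nat) : nat := size (Exc w).

Definition Esub (w : seq nat) : seq nat :=
  [seq letter w i | i <- iota 1 (size w) & i \in Exc w].
Definition Nsub (w : seq nat) : seq nat :=
  [seq letter w i | i <- iota 1 (size w) & i \notin Exc w].

Definition inv (u : seq nat) : nat :=
  #|[set p : 'I_(size u) * 'I_(size u) |
      (p.1 < p.2)%N && (nth 0%N u p.1 > nth 0%N u p.2)%N]|.
Definition imv (u : seq nat) : nat :=
  #|[set p : 'I_(size u) * 'I_(size u) |
      (p.1 < p.2)%N && (nth 0%N u p.1 >= nth 0%N u p.2)%N]|.

Definition denH (w : seq nat) : nat :=
  (\sum_(i <- Exc w) i + imv (Esub w) + inv (Nsub w))%N.

Section SignedStatistics.

Variables (n : nat) (s : {perm 'I_n.*2.+1}).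

Definition abs_word : seq nat := [seq `|x|%N | x <- window s].

Definition DNeg : seq nat := [seq i <- iota 1 n | sapp s i < -1].
Definition dneg : nat := size DNeg.

Definition ddes : nat := (des (window s) + dneg)%N.
Definition dexc : nat := (exc abs_word + dneg)%N.

Definition dmaj : int :=
  (maj (window s))%:Z - \sum_(i <- DNeg) sapp s i - dneg%:Z.
Definition dden : int :=
  (denH abs_word)%:Z - \sum_(i <- DNeg) sapp s i - dneg%:Z.

(* The next facts justify reading dmaj and dden as natural number exponents,  *)
(* through the absolute value.                                                *)

Lemma DNeg_weight_ge0 : 0 <= - \sum_(i <- DNeg) sapp s i - dneg%:Z.
Proof.
rewrite /dneg -sum1_size -natz natr_sum -opprD -big_split /= -sumrN big_seq.
apply: sumr_ge0 => i; rewrite mem_filter => /andP[lti _].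
by rewrite oppr_ge0 -lerBrDr sub0r ltW.
Qed.

Lemma dmaj_ge0 : 0 <= dmaj.
Proof. by rewrite /dmaj -addrA addr_ge0 ?DNeg_weight_ge0. Qed.

Lemma dden_ge0 : 0 <= dden.
Proof. by rewrite /dden -addrA addr_ge0 ?DNeg_weight_ge0. Qed.

End SignedStatistics.

(* The two indeterminates of Z[q][t]. *)
Definition qvar : {poly {poly int}} := 'X%:P.
Definition tvar : {poly {poly int}} := 'X.

(* Main.v *)
From mathcomp Require Import all_boot all_order all_algebra all_fingroup.
From mathcomp Require Import zify.
Require Import Defs.

(* Both statistics are the value of the same weight on the multiset of        *)
(* letters plus (denH, exc) of the word of absolute values, resp. (maj, des)  *)
(* of the word itself. Grouping D_n by the multiset of window letters thus    *)
(* reduces the theorem to the equidistribution of (denH, exc) and (maj, des)  *)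
(* on S_n. For the latter, inserting the letter n + 1 in all possible ways in *)
(* a word with statistics (a, e) must yield the statistics (a + c, e) for     *)
(* 0 <= c <= e and (a + c, e + 1) for e < c <= n. For (maj, des) this is      *)
(* Carlitz's insertion. For (denH, exc), n + 1 replaces the letter at some    *)
(* position, and the replaced letter is carried to the right: it is exchanged *)
(* with the current letter u at position i exactly when both or none of the   *)
(* two exceed i. The effect on denH is easy to follow on Denert's original    *)
(* description, which counts the pairs l < k such that w_l lies in the cyclic *)
(* interval ]w_k, k].                                                         *)

Set Implicit Arguments.
Unset Strict Implicit.
Unset Printing Implicit Defensive.
Import Order.TTheory GRing.Theory Num.Theory.

Local Open Scope nat_scope.

(** Both insertions have the same list of increments: by [majfrom_maxins] and [denfrom_excins] it is
    [labels] of the descent, resp. excedance, marks, and by [perm_labels] it depends, up to order,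
    only on the length and the number of marks. So both pairs of statistics obey one recursion
    ([denfrom_majfrom]), and [denfrom_denH] turns Denert's count into [denH]. For signed words with
    fixed letters, [sum_permutations_qt_weight] relabels the letters by absolute value on the [denH]
    side but by rank on the [maj] side; both relabellings run over S_n. Finally D_n is a union of
    such classes, since the number of negative letters ignores their order. *)

Lemma count_split (T : Type) (a b c : pred T) s :
  (forall t, c t = a t + b t :> nat) -> count c s = count a s + count b s.
Proof. by move=> cE; elim: s => //= t s ->; rewrite cE addnACA. Qed.

Lemma perm_swap (T : eqType) (x y : T) s : perm_eq (x :: y :: s) (y :: x :: s).
Proof. by rewrite -cat1s -[y :: s]cat1s perm_catCA. Qed.

(** * Increments under insertion of a new maximum *)

(* The increments of the two statistics for all insertions of a new maximum   *)
(* in a word, whose descents, resp. excedances, from position i on are marked *)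
(* by b; the last pair is for the insertion at the end.                       *)
Fixpoint labels (i : nat) (b : bitseq) : seq (nat * nat) :=
  match b with
  | [::] => [:: (0, 0)]
  | true :: b' => ((count id b').+1, 0) :: labels i.+1 b'
  | false :: b' => (i + count id b', 1) :: labels i.+1 b'
  end.

Lemma labels_cons i b bs : labels i (b :: bs)
  = (if b then ((count id bs).+1, 0) else (i + count id bs, 1)) :: labels i.+1 bs.
Proof. by case: b. Qed.

Definition std_labels (i e m : nat) : seq (nat * nat) :=
  [seq (c, 0) | c <- iota 0 e.+1] ++ [seq (c, 1) | c <- iota (i + e) (m - e)].

(** A marked head adds the top value of the first block, an unmarked head the bottom value of the
    second one. *)
Lemma perm_labels i b : perm_eq (labels i b) (std_labels i (count id b) (size b)).
Proof.
elim: b i => [|[] b IHb] i //; rewrite /std_labels.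
  rewrite [count _ _]/= add1n -[_.+2]addn1 iotaD map_cat -catA perm_sym perm_catCA.
  rewrite [labels _ _]/= perm_cons perm_sym addnS -addSn; exact: IHb.
rewrite [count _ _]/= add0n [size _]/= subSn ?count_size //.
rewrite [iota (i + _) _]/= map_cons -addSn -[(_, 1) :: _]cat1s perm_sym.
rewrite perm_catCA.
rewrite [labels _ _]/= cat1s perm_cons perm_sym; exact: IHb.
Qed.

(** Surjectivity of the insertion suffices: the n! words yield (n+1)! results in all, so every
    permutation occurs exactly once. *)
Lemma sum_permutationsS (V : nmodType) (g : seq nat -> seq (seq nat)) n
    (F : seq nat -> V) :
    (forall w, size (g w) = (size w).+1) ->
    (forall v, perm_eq v (iota 1 n.+1) ->
       exists2 w, perm_eq w (iota 1 n) & v \in g w) ->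
  (\sum_(v <- permutations (iota 1 n.+1)) F v
     = \sum_(w <- permutations (iota 1 n)) \sum_(v <- g w) F v)%R.
Proof.
move=> size_g sub_g.
set L := flatten [seq g w | w <- permutations (iota 1 n)].
have sizeL : size L = (n.+1)`!.
  rewrite size_flatten /shape -map_comp factS -[n in n`!](size_iota 1).
  rewrite -(size_permutations (iota_uniq 1 n)).
  have: all (fun w => size w == n) (permutations (iota 1 n)).
    apply/allP => w; rewrite mem_permutations => /perm_size ->.
    by rewrite size_iota.
  elim: (permutations _) => [|w s IHs] /= => [|/andP[/eqP sz_w /IHs ->]].
    by rewrite muln0.
  by rewrite size_g sz_w mulnS.
have uniqP := permutations_uniq (iota 1 n.+1).
have sizeP : size (permutations (iota 1 n.+1)) = (n.+1)`!.
  by rewrite size_permutations ?iota_uniq ?size_iota.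
have subL : {subset permutations (iota 1 n.+1) <= L}.
  move=> v; rewrite mem_permutations => /sub_g[w w_n v_w].
  by apply/flatten_mapP; exists w; rewrite ?mem_permutations.
have [|_ eqPL] := uniq_min_size uniqP subL; first by rewrite sizeL sizeP.
have permPL : perm_eq (permutations (iota 1 n.+1)) L.
  apply: uniq_perm => //; apply: (leq_size_uniq uniqP subL).
  by rewrite sizeL sizeP.
by rewrite (perm_big _ permPL) /= big_flatten big_map.
Qed.

(** * Carlitz's insertion for (maj, des) *)

(* Here w is preceded by the letter a, at position i. Using a = 0 at position *)
(* 0 for a whole word lets an insertion in front behave as the other ones.    *)
Fixpoint majfrom (i a : nat) (w : seq nat) : nat :=
  if w is u :: w' then (u < a) * i + majfrom i.+1 u w' else 0.

Fixpoint desmarks (a : nat) (w : seq nat) : bitseq :=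
  if w is u :: w' then (u < a) :: desmarks u w' else [::].

Fixpoint maxins (N : nat) (w : seq nat) : seq (seq nat) :=
  if w is u :: w' then (N :: w) :: [seq u :: v | v <- maxins N w']
  else [:: [:: N]].

Lemma size_desmarks a w : size (desmarks a w) = size w.
Proof. by elim: w a => //= u w IHw a; rewrite IHw. Qed.

Lemma majfromS i a w : majfrom i.+1 a w = majfrom i a w + count id (desmarks a w).
Proof. by elim: w i a => //= u w IHw i a; rewrite IHw; lia. Qed.

(** Inserting [N] right after [a] creates a descent at [i.+1], destroys the one at [i] if there is
    one, and shifts all later descents by one. *)
Lemma majfrom_maxins N i a w : all (gtn N) (a :: w) ->
  [seq (majfrom i a v, count id (desmarks a v)) | v <- maxins N w]
  = [seq (majfrom i a w + c.1, count id (desmarks a w) + c.2)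
      | c <- labels i.+1 (desmarks a w)].
Proof.
elim: w i a => [|u w IHw] i a.
  by rewrite /= andbT => ltaN; rewrite [N < a]ltnNge ltnW.
case/and3P=> ltaN ltuN ltwN.
have /(IHw i.+1) {}IHw : all (gtn N) (u :: w) by apply/andP; split.
rewrite [desmarks a _]/= labels_cons.
simpl in ltaN, ltuN.
rewrite /= ltuN (leq_gtF (ltnW ltaN)) majfromS; congr (_ :: _).
  by case: ifP => ltua /=; congr pair; lia.
(* The other insertions keep [u] next to [a], whose contribution is a constant added to the
   induction hypothesis. *)
rewrite -map_comp (eq_map (g := (fun p : nat * nat =>
  ((u < a) * i + p.1, (u < a) + p.2)) \o
  (fun v => (majfrom i.+1 u v, count id (desmarks u v))))) //.
rewrite map_comp IHw.
by rewrite -map_comp; apply: eq_map => c /=; rewrite !addnA.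
Qed.

Lemma size_maxins N w : size (maxins N w) = (size w).+1.
Proof. by elim: w => //= u w IHw; rewrite size_map IHw. Qed.

Lemma mem_maxins N v1 v2 : v1 ++ N :: v2 \in maxins N (v1 ++ v2).
Proof.
elim: v1 => [|u v1 IHv] /=; first by case: v2 => *; rewrite inE eqxx.
by rewrite inE map_f ?orbT.
Qed.

Lemma perm_iotaS n v : perm_eq v (iota 1 n.+1) ->
  exists v1 v2, v = v1 ++ n.+1 :: v2 /\ perm_eq (v1 ++ v2) (iota 1 n).
Proof.
move=> vP; have Nv: n.+1 \in v by rewrite (perm_mem vP) mem_iota; lia.
case/splitPr: v / Nv vP => v1 v2 vP; exists v1, v2; split=> //.
move: vP; rewrite -addn1 iotaD add1n addn1 /= cats1 perm_sym perm_rcons.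
by rewrite perm_sym perm_catC /= perm_cons perm_catC.
Qed.

Lemma maxins_surj n v : perm_eq v (iota 1 n.+1) ->
  exists2 w, perm_eq w (iota 1 n) & v \in maxins n.+1 w.
Proof.
by case/perm_iotaS=> v1 [v2 [-> vP]]; exists (v1 ++ v2); rewrite ?mem_maxins.
Qed.

(** * Insertion by carrying for Denert's statistic and exc *)

(* The word w starts at position i, and the letter x is carried. A step can   *)
(* be undone, since its condition is symmetric in the two letters.            *)
Fixpoint carry (i x : nat) (w : seq nat) : seq nat :=
  if w is u :: w' then
    if (i < x) == (i < u) then x :: carry i.+1 u w' else u :: carry i.+1 x w'
  else [:: x].

Fixpoint excins (N i : nat) (w : seq nat) : seq (seq nat) :=
  if w is u :: w' then (N :: carry i.+1 u w') :: [seq u :: v | v <- excins N i.+1 w']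
  else [:: [:: N]].

(* s lies in the cyclic interval ]u, k].                                      *)
Definition cyc (u k s : nat) : bool :=
  if k < u then (u < s) || (s <= k) else u < s <= k.

(* Denert's description; s lists the letters preceding w, whose first         *)
(* position is i.                                                             *)
Fixpoint denfrom (i : nat) (s w : seq nat) : nat :=
  if w is u :: w' then count (cyc u i) s + denfrom i.+1 (u :: s) w' else 0.

Fixpoint excmarks (i : nat) (w : seq nat) : bitseq :=
  if w is u :: w' then (i < u) :: excmarks i.+1 w' else [::].

Lemma size_excmarks i w : size (excmarks i w) = size w.
Proof. by elim: w i => //= u w IHw i; rewrite IHw. Qed.

Lemma perm_carry i x w : perm_eq (carry i x w) (x :: w).
Proof.
elim: w i x => //= u w IHw i x; case: ifP => _; first by rewrite perm_cons.
by apply: perm_trans (perm_swap u x w); rewrite perm_cons.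
Qed.

(** Undo the carrying from the right: the first letter [z] was carried in if it lies on the same
    side of [i] as the letter carried on, and was left in place otherwise. *)
Lemma carry_surj i v : v != [::] -> exists x w, v = carry i x w.
Proof.
elim: v i => // z [_ i _|y v IHv i _]; first by exists z, [::].
have [//|x [w ->]] := IHv i.+1.
case: (boolP ((i < z) == (i < x))) => zx.
  by exists z, (x :: w); rewrite /= zx.
by exists x, (z :: w); rewrite /= eq_sym (negPf zx).
Qed.

(** Exchanges preserve the mark at each position, and the letter dropped at the end is too small to
    be an excedance. *)
Lemma excmarks_carry i x w : all (geq (i + size w)) (x :: w) ->
  count id (excmarks i (carry i x w)) = count id (excmarks i w).
Proof.
elim: w i x => [|u w IHw] i x /=; first by rewrite addn0 andbT ltnNge => ->.
rewrite addnS => /and3P[lex leu lew].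
by case: ifP => [/eqP xu|xu] /=; rewrite IHw /= ?lex ?leu // xu.
Qed.

(** Compared with [s], the new prefix [s'] has gained [N] and lacks the letter [x] still in hand;
    both kinds of step keep this invariant. At the end [x] lands at position [N] and counts all
    letters above it, [N] included. *)
Lemma denfrom_carry N i x s s' w :
    i + size w = N -> all (gtn N) (x :: s ++ w) -> perm_eq (x :: s') (N :: s) ->
  denfrom i s' (carry i x w)
  = denfrom i s w + count (ltn x) s + count id (excmarks i w) + 1.
Proof.
elim: w i x s s' => [|u w IHw] i x s s' /=.
  rewrite addn0 cats0 => -> /andP[ltxN lts] /seq.permP sE.
  have cyc_xx : cyc x N x = false by rewrite /cyc ltnn (leq_gtF (ltnW ltxN)).
  have cyc_xN : cyc x N N by rewrite /cyc (leq_gtF (ltnW ltxN)) leqnn andbT.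
  have eqxN : count (cyc x N) s = count (ltn x) s.
    apply: eq_in_count => t /(allP lts) /= lttN.
    by rewrite /cyc (leq_gtF (ltnW ltxN)) (ltnW lttN) andbT.
  by have := sE (cyc x N); rewrite /= cyc_xx cyc_xN eqxN; lia.
rewrite addnS all_cat /= => iwN /and4P[ltxN lts ltuN ltw] sE.
have ltiN : i < N by lia.
have ih y t' : all (gtn N) [:: y] -> perm_eq (y :: t') (N :: u :: s) ->
  denfrom i.+1 t' (carry i.+1 y w)
  = denfrom i.+1 (u :: s) w + count (ltn y) (u :: s) + count id (excmarks i.+1 w) + 1.
  move=> /= /andP[lty _] tE; apply: (IHw i.+1) => //=.
  by rewrite all_cat lty ltuN lts.
have cnt P := seq.permP sE P.
(* This and the next two facts reduce cyclic intervals to linear ones, leaving linear arithmetic. *)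
have splitc y z : y <= z ->
    count (ltn y) s = count (ltn z) s + count (fun t => y < t <= z) s.
  by move=> leyz; apply: count_split => t /=; lia.
have splitcyc y z : z < y -> count (cyc y z) s = count (ltn y) s + count (geq z) s.
  by move=> ltzy; apply: count_split => t /=; rewrite /cyc ltzy; lia.
have cycle y z : y <= z -> count (cyc y z) s = count (fun t => y < t <= z) s.
  by move=> leyz; apply: eq_count => t; rewrite /cyc ltnNge leyz.
case: ifP => [/eqP xu|/negbT xu] /=.
  rewrite (ih u (x :: s')) /= ?ltuN //; last first.
    by apply: perm_trans (perm_swap u N s); rewrite perm_cons.
  have := cnt (cyc x i); rewrite /= ltnn.
  case: (ltnP i x) xu => [ltix|leix] /esym ltiu.
    rewrite !splitcyc // /cyc ltix ltnn ltxN leqNgt ltix /=; lia.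
  have leui : u <= i by rewrite leqNgt ltiu.
  rewrite !cycle // (splitc u i) // (splitc x i) // /cyc ltiu.
  rewrite !(leq_gtF leix) !ltnn !(leqNgt N) ltiN ?andbF /=; lia.
rewrite (ih x (u :: s')) /= ?ltxN //; last first.
  apply: perm_trans (perm_swap x u s') _; apply: perm_trans (perm_swap u N s).
  by rewrite perm_cons.
have := cnt (cyc u i); rewrite /= /cyc.
case: (ltnP i u) xu; case: (ltnP i x) => //=; lia.
Qed.

(** Replacing [u], the letter [N] counts the letters of [s] up to [i]; [denfrom_carry] gives the
    rest. If [u] exceeds [i], this cancels the former count of [u], up to the later excedances plus
    1. Otherwise the letters up to [i] and beyond [i] add up to all [i - 1] letters of [s]. *)
Lemma denfrom_excins N i s w :
    i + size w = N -> i = (size s).+1 -> all (gtn N) (s ++ w) ->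
  [seq (denfrom i s v, count id (excmarks i v)) | v <- excins N i w]
  = [seq (denfrom i s w + c.1, count id (excmarks i w) + c.2)
      | c <- labels i (excmarks i w)].
Proof.
elim: w i s => [|u w IHw] i s.
  rewrite /= addn0 cats0 => -> _ ltsN; rewrite ltnn addn0; congr [:: (_, _)].
  by rewrite addn0 -(count_pred0 s); apply: eq_count => t; rewrite /cyc ltnn /=; lia.
rewrite [size _]/= addnS => iwN szs ltN; have ltiN : i < N by lia.
move: (ltN); rewrite all_cat => /and3P[lts ltuN ltw]; simpl in ltuN.
have {}IHw :
    [seq (denfrom i.+1 (u :: s) v, count id (excmarks i.+1 v)) | v <- excins N i.+1 w]
  = [seq (denfrom i.+1 (u :: s) w + c.1, count id (excmarks i.+1 w) + c.2)
      | c <- labels i.+1 (excmarks i.+1 w)].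
  by apply: IHw; [rewrite addSn | rewrite szs | rewrite /= all_cat ltuN lts].
rewrite [excmarks i _]/= labels_cons /=; congr (_ :: _); last first.
  rewrite -map_comp (eq_map (g := (fun p : nat * nat =>
    (count (cyc u i) s + p.1, (i < u) + p.2)) \o
    (fun v => (denfrom i.+1 (u :: s) v, count id (excmarks i.+1 v))))) //.
  by rewrite map_comp IHw -map_comp; apply: eq_map => c /=; rewrite !addnA.
rewrite (denfrom_carry (N := N) (s := u :: s)) ?addSn //=; last first.
- exact: perm_swap.
- by rewrite all_cat ltuN lts.
rewrite excmarks_carry; last first.
  rewrite /=; apply/andP; split; first lia.
  by apply/allP => t /(allP ltw) /=; lia.
have split_s : size s = count (geq i) s + count (ltn i) s.
  by rewrite -count_predT; apply: count_split => t /=; lia.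
rewrite ltiN ltnn add0n.
have -> : count (cyc N i) s = count (geq i) s.
  by apply: eq_in_count => t /(allP lts) /=; rewrite /cyc ltiN; lia.
case: ifP => iu /=; congr pair; try lia.
  rewrite [count (cyc u i) s](_ : _ = count (ltn u) s + count (geq i) s); first lia.
  by apply: count_split => t /=; rewrite /cyc iu; lia.
suff: count (ltn u) s = count (cyc u i) s + count (ltn i) s by lia.
by apply: count_split => t /=; rewrite /cyc iu; lia.
Qed.

Lemma size_excins N i w : size (excins N i w) = (size w).+1.
Proof. by elim: w i => //= u w IHw i; rewrite size_map IHw. Qed.

Lemma mem_excins N i v1 v2 :
  exists2 w, perm_eq w (v1 ++ v2) & v1 ++ N :: v2 \in excins N i w.
Proof.
elim: v1 i => [|u v1 IHv] i /=.
  have [->|/(carry_surj i.+1)[x [w ->]]] := eqVneq v2 [::].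
    by exists [::]; rewrite //= inE.
  by exists (x :: w); rewrite /= ?inE ?eqxx // perm_sym perm_carry.
have [w wP vw] := IHv i.+1; exists (u :: w); first by rewrite perm_cons.
by rewrite /= inE map_f ?orbT.
Qed.

Lemma excins_surj n v : perm_eq v (iota 1 n.+1) ->
  exists2 w, perm_eq w (iota 1 n) & v \in excins n.+1 1 w.
Proof.
case/perm_iotaS=> v1 [v2 [-> vP]]; have [w wP ?] := mem_excins n.+1 1 v1 v2.
by exists w => //; exact: perm_trans vP.
Qed.

(** With [h] arbitrary, the sum [h'] over all insertions is again a function of the two statistics,
    so the induction hypothesis applies to it. *)
Lemma denfrom_majfrom (V : nmodType) (h : nat -> nat -> V) n :
  (\sum_(w <- permutations (iota 1 n))
      h (denfrom 1 [::] w) (count id (excmarks 1 w))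
   = \sum_(w <- permutations (iota 1 n))
      h (majfrom 0 0 w) (count id (desmarks 0 w)))%R.
Proof.
elim: n h => [|n IHn] h; first by rewrite !big_seq1.
rewrite (sum_permutationsS _ (size_excins n.+1 1) (@excins_surj n)).
rewrite (sum_permutationsS _ (size_maxins n.+1) (@maxins_surj n)).
pose h' d e := (\sum_(c <- std_labels 1 e n) h (d + c.1) (e + c.2))%R.
have sum_labels d b : size b = n ->
    (\sum_(c <- labels 1 b) h (d + c.1)%N (count id b + c.2)%N)%R = h' d (count id b).
  by move=> szb; rewrite (perm_big _ (perm_labels 1 b)) /= szb.
transitivity (\sum_(w <- permutations (iota 1 n))
      h' (denfrom 1 [::] w) (count id (excmarks 1 w)))%R; last first.
  rewrite IHn; apply: eq_big_seq => w; rewrite mem_permutations => wP.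
  have szw : size w = n by rewrite (perm_size wP) size_iota.
  have ltw : all (gtn n.+1) (0 :: w).
    by apply/allP => t; rewrite inE (perm_mem wP) mem_iota /=; lia.
  rewrite -sum_labels ?size_desmarks //.
  have := congr1 (fun l => \sum_(p <- l) h p.1 p.2)%R (majfrom_maxins 0 ltw).
  by rewrite !big_map.
apply: eq_big_seq => w; rewrite mem_permutations => wP.
have szw : size w = n by rewrite (perm_size wP) size_iota.
have ltw : all (gtn n.+1) w.
  by apply/allP => t; rewrite (perm_mem wP) mem_iota /=; lia.
rewrite -sum_labels ?size_excmarks //.
have := congr1 (fun l => \sum_(p <- l) h p.1 p.2)%R
  (@denfrom_excins n.+1 1 [::] w _ erefl ltw).
by rewrite szw !big_map => ->.
Qed.

(** * Denert's count equals [denH] *)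

(* Pairs l < k of excedances or of non-excedances give the inversion terms.   *)
(* The other pairs are reduced to pairs of excedances by distf, and add up to *)
(* the sum of the excedance positions.                                        *)
Lemma denert_identity n (f : nat -> nat) (e := fun k => k.+1 < f k) :
    {in gtn n &, injective f} ->
    (forall v, \sum_(k < n) (f k < v) = \sum_(k < n) (k.+1 < v)) ->
  \sum_(k < n) \sum_(l < n) ((l < k) && cyc (f k) k.+1 (f l))
  = \sum_(k < n | e k) k.+1
    + \sum_(l < n | e l) \sum_(k < n | e k) ((l < k) && (f k <= f l))
    + \sum_(l < n | ~~ e l) \sum_(k < n | ~~ e k) ((l < k) && (f k < f l)).
Proof.
move=> injf_in distf.
have injf k l : k < n -> l < n -> f k = f l -> k = l by move=> *; exact: injf_in.
pose S (F : nat -> nat -> bool) := \sum_(k < n) \sum_(l < n) F k l.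
have tr F : S F = S (fun k l => F l k) by rewrite /S exchange_big.
have spl (F G H : nat -> nat -> bool) :
    (forall k l, k < n -> l < n -> F k l = G k l + H k l :> nat) -> S F = S G + S H.
  move=> FGH; rewrite /S -big_split; apply: eq_bigr => k _; rewrite -big_split.
  by apply: eq_bigr => l _; apply: FGH.
(* The pairs counted on the left split into [A], [B], [X] and [Y]; the sum of the excedance
   positions splits into [Y] and [Y']. It remains to compare [X] with [Y'], through [Z]. *)
pose A k l := [&& l < k, e l, e k & f k <= f l].
pose B k l := [&& l < k, ~~ e l, ~~ e k & f k < f l].
pose Y k l := [&& e k, l < k & f l <= k.+1].
pose X k l := (f k < f l <= k.+1) && e l.
pose Z k l := (k.+1 < f l <= f k) && e l.
pose Y' k l := [&& e k, l <= k & k.+1 < f l].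
have XZ : S X = S Z.
  rewrite tr (tr Z) /S; apply: eq_bigr => l _.
  case el: (e l) => /=; last by apply: eq_bigr => k _; rewrite /X /Z el !andbF.
  (* Adding the [k] for which both [f k] and [k.+1] lie below [f l] completes both sides to the two
     counts in [distf]. *)
  apply: (@addIn (\sum_(k < n) ((f k < f l) && (k.+1 < f l)))).
  rewrite -!big_split.
  transitivity (\sum_(k < n) (f k < f l)).
    by apply: eq_bigr => k _; rewrite /X el /=; lia.
  by rewrite distf; apply: eq_bigr => k _; rewrite /Z el /=; lia.
have ZY' : S Z = S Y'.
  (* The pairs of [Y'] are separated by the order of [f l] and [f k]; those with [f k < f l] are
     pairs of [Z] with the indices exchanged. *)
  rewrite (spl Z (fun k l => (l <= k) && Z k l) (fun k l => (k < l) && Z k l)); last first.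
    by move=> k l _ _; case: leqP; rewrite ?addn0.
  rewrite (tr (fun k l => (k < l) && Z k l)); symmetry; apply: spl => k l kn ln.
  have := injf k l kn ln; rewrite /Z /Y' /e; case: (ltngtP l k) => [||->] /=; lia.
have sumE : \sum_(k < n | e k) k.+1 = S (fun k l => e k && (l <= k)).
  rewrite /S big_mkcond; apply: eq_bigr => k _; case: (e k) => /=; last by rewrite big1.
  transitivity (\sum_(0 <= l < k.+1) 1); first by rewrite sum_nat_const_nat; lia.
  rewrite (big_nat_widen 0 k.+1 n) //.
  by rewrite big_mkord big_mkcond; apply: eq_bigr => l _; rewrite ltnS; case: leqP.
have sumA : \sum_(l < n | e l) \sum_(k < n | e k) ((l < k) && (f k <= f l)) = S A.
  rewrite tr /S big_mkcond; apply: eq_bigr => l _.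
  rewrite big_mkcond; case el: (e l) => /=; last by rewrite big1 // => k _; rewrite /A el andbF.
  by apply: eq_bigr => k _; rewrite /A el; case: (e k); rewrite ?andbF.
have sumB : \sum_(l < n | ~~ e l) \sum_(k < n | ~~ e k) ((l < k) && (f k < f l)) = S B.
  rewrite tr /S big_mkcond; apply: eq_bigr => l _.
  rewrite big_mkcond; case el: (e l) => /=; first by rewrite big1 // => k _; rewrite /B el andbF.
  by apply: eq_bigr => k _; rewrite /B el; case: (e k); rewrite ?andbF.
rewrite sumE sumA sumB -/(S (fun k l => (l < k) && cyc (f k) k.+1 (f l))).
rewrite (spl (fun k l => e k && (l <= k)) Y Y') -?ZY' -?XZ; last first.
  by move=> k l _ _; rewrite /Y /Y' /e; case: (ltngtP l k) => [||->] /=; lia.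
pose AB k l := A k l || B k l; pose XY k l := X k l || Y k l.
rewrite (spl _ AB XY); last first.
  move=> k l kn ln; have := injf k l kn ln.
  by rewrite /AB /XY /A /B /X /Y /cyc /e; case: (ltnP k.+1 (f k)); lia.
rewrite (spl AB A B); last by move=> k l _ _; rewrite /AB /A /B; case: (e k); lia.
rewrite (spl XY X Y); last first.
  by move=> k l _ _; rewrite /XY /X /Y /e; lia.
lia.
Qed.

Lemma ExcE w : Exc w = [seq k.+1 | k <- iota 0 (size w) & k.+1 < nth 0 w k].
Proof. by rewrite /Exc (iotaDl 1 0) filter_map. Qed.

Lemma count_excmarks i w :
  count id (excmarks i w) = count (fun k => i + k < nth 0 w k) (iota 0 (size w)).
Proof.
elim: w i => //= u w IHw i; rewrite addn0 IHw (iotaDl 1 0) count_map.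
by congr (_ + _); apply: eq_count => k /=; rewrite addSnnS.
Qed.

Lemma exc_excmarks w : exc w = count id (excmarks 1 w).
Proof. by rewrite /exc ExcE size_map size_filter count_excmarks. Qed.

Lemma denfrom_sum i s w : i = (size s).+1 ->
  denfrom i (rev s) w
  = \sum_(size s <= k < size (s ++ w)) count (cyc (nth 0 (s ++ w) k) k.+1) (take k (s ++ w)).
Proof.
elim: w i s => [|u w IHw] i s -> /=; first by rewrite cats0 big_geq.
rewrite big_ltn; last by rewrite size_cat /= addnS ltnS leq_addr.
rewrite nth_cat ltnn subnn take_size_cat //= count_rev; congr (_ + _).
by rewrite -rev_rcons IHw ?size_rcons // -cat_rcons.
Qed.

Lemma denfrom_double_sum w (f := nth 0 w) :
  denfrom 1 [::] w
  = \sum_(k < size w) \sum_(l < size w) ((l < k) && cyc (f k) k.+1 (f l)).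
Proof.
rewrite (@denfrom_sum 1 [::]) //= big_mkord; apply: eq_bigr => k _.
rewrite -(map_nth_iota0 0); last exact: ltnW.
rewrite count_map -sum1_count -[k in iota _ k]subn0.
rewrite -/(index_iota 0 k) (big_nat_widen _ _ (size w)); last exact: ltnW.
rewrite big_mkord big_mkcond; apply: eq_bigr => l _ /=.
by rewrite andbC; case: ifP.
Qed.

(** Since [I] increases, places in the subword compare as the positions they come from. *)
Lemma card_word_pairs (r : rel nat) (g : nat -> nat) I (u := [seq g i | i <- I]) :
    sorted ltn I ->
  #|[set p : 'I_(size u) * 'I_(size u) | (p.1 < p.2) && r (nth 0 u p.1) (nth 0 u p.2)]|
  = \sum_(i <- I) \sum_(j <- I) ((i < j) && r (g i) (g j)).
Proof.
move=> ltI; rewrite -sum1dep_card big_mkcond.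
rewrite -(pair_bigA _ (fun a b : 'I_(size u) =>
  if (a < b) && r (nth 0 u a) (nth 0 u b) then 1 else 0)) /=.
have szu : size u = size I by rewrite size_map.
rewrite (big_nth 0) -szu big_mkord; apply: eq_bigr => a _.
rewrite (big_nth 0) -szu big_mkord; apply: eq_bigr => b _.
have lta : a < size I by rewrite -szu.
have ltb : b < size I by rewrite -szu.
have homoI := sorted_ltn_nth ltn_trans 0 ltI.
rewrite !(nth_map 0) // [nth 0 I a < _](_ : _ = (a < b)); first by case: ifP.
case: (ltngtP a b) => [ab|ba|->]; last by rewrite ltnn.
  by rewrite homoI ?inE.
by rewrite ltnNge ltnW // homoI ?inE.
Qed.

Lemma perm_iota_inj n w : perm_eq w (iota 1 n) -> {in gtn n &, injective (nth 0 w)}.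
Proof.
move=> wP k l; rewrite !unfold_in => kn ln /eqP.
have szw : size w = n by rewrite (perm_size wP) size_iota.
have uw : uniq w by rewrite (perm_uniq wP) iota_uniq.
by rewrite nth_uniq ?szw // => /eqP.
Qed.


Lemma denfrom_denH n w : perm_eq w (iota 1 n) -> denfrom 1 [::] w = denH w.
Proof.
move=> wP; have szw : size w = n by rewrite (perm_size wP) size_iota.
have sumI (P : pred nat) (F : nat -> nat) :
    \sum_(k <- iota 0 n | P k) F k = \sum_(k < n | P k) F k.
  by rewrite -[n in iota 0 n]subn0 -/(index_iota 0 n) big_mkord.
rewrite denfrom_double_sum szw denert_identity; first last.
(* Both sides count the letters below [v], as [w] rearranges 1, ..., n. *)
- move=> v; rewrite -(sumI xpredT (fun k => nth 0 w k < v : nat)).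
  rewrite -(sumI xpredT (fun k => k.+1 < v : nat)).
  transitivity (count (gtn v) w).
    rewrite -[w in RHS]take_size -(map_nth_iota0 0) // szw count_map -sum1_count.
    by rewrite [RHS]big_mkcond; apply: eq_bigr => k _ /=; case: ifP.
  rewrite (seq.permP wP) (iotaDl 1 0) count_map -sum1_count big_mkcond.
  by apply: eq_bigr => k _ /=; case: ifP.
- exact: perm_iota_inj wP.
have sub (P : pred nat) : [seq letter w i | i <- iota 1 n & P i]
    = [seq nth 0 w k | k <- iota 0 n & P k.+1].
  by rewrite (iotaDl 1 0) filter_map -map_comp.
have sortP (P : pred nat) : sorted ltn [seq k <- iota 0 n | P k].
  exact: (sorted_filter ltn_trans _ (iota_ltn_sorted _ _)).
have memExc k : k < n -> (k.+1 \in Exc w) = (k.+1 < nth 0 w k).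
  move=> kn; rewrite ExcE szw mem_map; last exact: succn_inj.
  by rewrite mem_filter mem_iota add0n kn /= andbT.
have eqE : Esub w = [seq nth 0 w k | k <- iota 0 n & k.+1 < nth 0 w k].
  rewrite /Esub szw sub; congr map; apply: eq_in_filter => k.
  by rewrite mem_iota => /memExc.
have eqN : Nsub w = [seq nth 0 w k | k <- iota 0 n & ~~ (k.+1 < nth 0 w k)].
  rewrite /Nsub szw sub; congr map; apply: eq_in_filter => k.
  by rewrite mem_iota => /memExc ->.
rewrite /denH; congr (_ + _ + _).
- by rewrite ExcE szw big_map big_filter sumI.
- rewrite eqE /imv (card_word_pairs geq) // big_filter sumI; apply: eq_bigr => l _.
  by rewrite big_filter sumI.
pose I := [seq k <- iota 0 n | ~~ (k.+1 < nth 0 w k)].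
rewrite eqN -/I; transitivity
  (\sum_(i <- I) \sum_(j <- I) ((i < j) && (nth 0 w j < nth 0 w i))); last first.
  by rewrite -(card_word_pairs (fun a b => b < a) (nth 0 w) (sortP _)).
rewrite /I big_filter sumI; apply: eq_bigr => l _.
by rewrite big_filter sumI.
Qed.

(** * Transport of maj and des along increasing relabellings *)

Lemma count_desmarks u w : count id (desmarks u w)
  = count (fun k => nth 0 w k < nth 0 (u :: w) k) (iota 0 (size w)).
Proof.
elim: w u => //= x w IHw u; rewrite IHw (iotaDl 1 0) count_map.
by congr (_ + _); apply: eq_count => -[].
Qed.

Lemma majfrom_sum i u w : majfrom i u w
  = \sum_(k <- iota 0 (size w) | nth 0 w k < nth 0 (u :: w) k) (i + k).
Proof.
elim: w i u => [|x w IHw] i u /=; first by rewrite big_nil.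
rewrite big_cons (iotaDl 1 0) big_map /= addn0 IHw.
have -> : \sum_(k <- iota 0 (size w) | nth 0 w k < nth 0 (x :: w) k) (i.+1 + k)
  = \sum_(k <- iota 0 (size w) | nth 0 w k < nth 0 (x :: w) k) (i + (1 + k)).
  by apply: eq_bigr => k _; rewrite addnA addn1.
by case: ifP; rewrite ?mul1n ?mul0n.
Qed.

Lemma Des_map (f : nat -> int) u w :
    {in u :: w &, {mono f : x y / x < y >-> (x < y)%R}} ->
  Des [seq f x | x <- u :: w]
  = [seq k.+1 | k <- iota 0 (size w) & nth 0 w k < nth 0 (u :: w) k].
Proof.
move=> monof; rewrite /Des /= size_map (iotaDl 1 0) filter_map.
congr map; apply: eq_in_filter => k; rewrite mem_iota => /= kw.
rewrite /letter /= -[_ :: _]/(map f (u :: w)) !(nth_map 0%N) ?ltnS ?(ltnW kw) //.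
by rewrite monof ?mem_nth ?inE ?ltnS ?(ltnW kw) ?mem_nth ?orbT.
Qed.

Lemma maj_des_map (f : nat -> int) w :
    {in w &, {mono f : x y / x < y >-> (x < y)%R}} ->
  maj [seq f x | x <- w] = majfrom 0 0 w /\
  des [seq f x | x <- w] = count id (desmarks 0 w).
Proof.
case: w => [|u w] monof; first by rewrite /maj /des /Des big_nil.
rewrite /maj /des (Des_map monof) size_map big_map big_filter size_filter.
by rewrite /= majfrom_sum count_desmarks.
Qed.

Lemma perm_permutations_map (T1 T2 : eqType) (f : T1 -> T2) s :
    {in s &, injective f} -> uniq s ->
  perm_eq (permutations [seq f x | x <- s]) [seq [seq f x | x <- t] | t <- permutations s].
Proof.
move=> injf us; have ufs : uniq [seq f x | x <- s] by rewrite map_inj_in_uniq.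
have umap : uniq [seq [seq f x | x <- t] | t <- permutations s].
  rewrite map_inj_in_uniq ?permutations_uniq // => t1 t2.
  rewrite !mem_permutations => t1s t2s; apply: (inj_in_map injf).
    by apply/allP => x; rewrite (perm_mem t1s).
  by apply/allP => x; rewrite (perm_mem t2s).
have sub : {subset [seq [seq f x | x <- t] | t <- permutations s]
            <= permutations [seq f x | x <- s]}.
  by move=> _ /mapP[t + ->]; rewrite !mem_permutations; exact: perm_map.
rewrite perm_sym; have [|_ eqm] := uniq_min_size umap sub.
  by rewrite size_map !size_permutations // size_map.
exact: uniq_perm (permutations_uniq _) eqm.
Qed.

(** * The weight of the negative letters *)

Local Open Scope ring_scope.

(** The part common to [dden] and [dmaj], symmetric in the letters. *)
Definition neg_weight (v : seq int) : int :=
  - \sum_(x <- v | x < -1) x - (count (fun x => x < -1) v)%:Z.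

Definition qt_weight (v : seq int) (a b : nat) : {poly {poly int}} :=
  qvar ^+ absz (a%:Z + neg_weight v) * tvar ^+ (b + count (fun x => (x < -1)%R) v)%N.

Lemma dden_window n (s : {perm 'I_n.*2.+1}) : 
  qvar ^+ `|dden s|%N * tvar ^+ dexc s
  = qt_weight (window s) (denH (abs_word s)) (exc (abs_word s)).
Proof.
rewrite /qt_weight /neg_weight /dden /dexc /dneg /DNeg size_filter.
by rewrite big_filter /window big_map count_map addrA.
Qed.

Lemma dmaj_window n (s : {perm 'I_n.*2.+1}) : 
  qvar ^+ `|dmaj s|%N * tvar ^+ ddes s
  = qt_weight (window s) (maj (window s)) (des (window s)).
Proof.
rewrite /qt_weight /neg_weight /dmaj /ddes /dneg /DNeg size_filter.
by rewrite big_filter /window big_map count_map addrA.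
Qed.

Lemma perm_qt_weight u v : perm_eq u v -> qt_weight u =2 qt_weight v.
Proof.
by move=> uv a b; rewrite /qt_weight /neg_weight (perm_big _ uv) (seq.permP uv).
Qed.

(** * Signed permutations and their windows *)

Lemma sval_inj n : injective (@Defs.sval n).
Proof. by move=> j k; rewrite /sval => jk; apply: val_inj => /=; lia. Qed.

(* Inverse of Defs.sval, with a junk value when |z| > n.                      *)
Definition sord n (z : int) : 'I_n.*2.+1 := inord (absz (z + n%:Z)).

Lemma sordK n z : (`|z| <= n)%N -> sval (@sord n z) = z.
Proof. by move=> zn; rewrite /sval /sord inordK; lia. Qed.

Lemma sval_le n (k : 'I_n.*2.+1) : (`|sval k| <= n)%N.
Proof. by rewrite /sval; have := ltn_ord k; lia. Qed.

Lemma svalK n : cancel (@Defs.sval n) (@sord n).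
Proof. by move=> k; apply: sval_inj; rewrite sordK ?sval_le. Qed.

Lemma sapp_sord n (s : {perm 'I_n.*2.+1}) (i : nat) : sapp s i = sval (s (sord n i)).
Proof. by rewrite /sapp /sord; congr (sval (s (inord _))); lia. Qed.

Lemma B_sordN n s z : s \in B n -> (`|z| <= n)%N ->
  sval (s (sord n (- z))) = - sval (s (sord n z)).
Proof.
rewrite inE => /forallP sB zn; rewrite -sval_rev -(eqP (sB _)); congr (sval (s _)).
by apply: sval_inj; rewrite sval_rev !sordK ?abszN.
Qed.

Lemma B_sord0 n s : s \in B n -> sval (s (sord n 0)) = 0.
Proof.
move=> sB; have /eqP := B_sordN (z := 0) sB (leq0n n).
by rewrite oppr0 -addr_eq0 -mulr2n mulrn_eq0 => /eqP.
Qed.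

Lemma window_inj n : {in B n &, injective (@window n)}.
Proof.
move=> s t sB tB /eq_in_map st; apply/permP => k; apply: sval_inj.
have pos z : 0 < z -> (`|z| <= n)%N -> sval (s (sord n z)) = sval (t (sord n z)).
  case: z => // i i_gt0 lein.
  by have := st i; rewrite !sapp_sord; apply; rewrite mem_iota; lia.
rewrite -(svalK k); have := sval_le k; move: (sval k) => z zn.
case: (ltrgtP z 0) => [z_lt0|z_gt0|->]; last first.
- by rewrite !B_sord0.
- exact: pos.
- have Nz : sval (s (sord n (- z))) = sval (t (sord n (- z))).
    by apply: pos; rewrite ?oppr_gt0 ?abszN.
  by rewrite -(opprK z) B_sordN ?abszN // Nz -B_sordN ?abszN.
Qed.

Lemma abs_window n s : s \in B n -> perm_eq (abs_word s) (iota 1 n).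
Proof.
move=> sB; rewrite /abs_word /window -map_comp.
have s_eq z z' : (`|z| <= n)%N -> (`|z'| <= n)%N ->
    sval (s (sord n z)) = sval (s (sord n z')) -> z = z'.
  move=> zn z'n /sval_inj /perm_inj zz'.
  by rewrite -(sordK zn) zz' sordK.
have uw : uniq [seq absz (sapp s i) | i <- iota 1 n].
  rewrite map_inj_in_uniq ?iota_uniq // => i j; rewrite !mem_iota !sapp_sord => iP jP ij.
  have: sval (s (sord n i)) = sval (s (sord n j))
      \/ sval (s (sord n i)) = sval (s (sord n (- j%:Z))).
    by rewrite (B_sordN sB); lia.
  by case=> /s_eq; lia.
have sub : {subset [seq absz (sapp s i) | i <- iota 1 n] <= iota 1 n}.
  move=> _ /mapP[i + ->]; rewrite !mem_iota sapp_sord => iP.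
  have s0 := B_sord0 sB.
  have si_neq0 : sval (s (sord n i)) <> 0.
    by rewrite -s0 => /s_eq i0; have := i0 ltac:(lia) (leq0n n); lia.
  by have := sval_le (s (sord n i)); move: (sval _) si_neq0 => x; lia.
have [|_ eqw] := uniq_min_size uw sub; first by rewrite size_map.
exact: uniq_perm (iota_uniq _ _) eqw.
Qed.

Lemma window_surj n v : perm_eq [seq `|x|%N | x <- v] (iota 1 n) ->
  exists2 s, s \in B n & window s = v.
Proof.
(* [e] is the odd extension of [v]; at 0 the sign vanishes, so the index [0.-1] is harmless. *)
move=> vP; pose g i : int := nth 0 v i; pose e (z : int) : int := sgz z * g `|z|.-1.
have szv : size v = n by rewrite -(size_map absz) (perm_size vP) size_iota.
have abs_g i : (i < n)%N -> (1 <= `|g i| <= n)%N.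
  move=> lt_in; have: `|g i|%N \in iota 1 n.
    by rewrite -(perm_mem vP) map_f // mem_nth ?szv.
  by rewrite mem_iota; lia.
have uv : uniq [seq `|x|%N | x <- v] by rewrite (perm_uniq vP) iota_uniq.
have eN z : e (- z) = - e z by rewrite /e sgzN abszN mulNr.
have e_le z : (`|z| <= n)%N -> (`|e z| <= n)%N.
  rewrite /e abszM; case: (sgzP z) => [->|z_gt0|z_lt0] zn //=.
    by rewrite mul1n; have := abs_g `|z|.-1; lia.
  by rewrite mul1n; have := abs_g `|z|.-1; lia.
have absg_inj i j : (i < n)%N -> (j < n)%N -> `|g i|%N = `|g j|%N -> i = j.
  move=> lt_in lt_jn /eqP; rewrite -!(nth_map _ 0%N) ?szv //.
  by rewrite nth_uniq ?size_map ?szv // => /eqP.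
have e_inj z z' : (`|z| <= n)%N -> (`|z'| <= n)%N -> e z = e z' -> z = z'.
  move=> zn z'n; have gz := @abs_g `|z|.-1; have gz' := @abs_g `|z'|.-1.
  have gzz' := @absg_inj `|z|.-1 `|z'|.-1.
  have gg : `|z|.-1 = `|z'|.-1 -> g `|z|.-1 = g `|z'|.-1 by move=> ->.
  have eE y : e y = sgz y * g `|y|.-1 by [].
  rewrite !eE; move: (g _) (g _) gz gz' gzz' gg => x y {eE}.
  by case: (sgzP z) => [->|z_gt0|z_lt0]; case: (sgzP z') => [->|z'_gt0|z'_lt0];
    rewrite ?mul0r ?mul1r ?mulN1r; lia.
pose f (k : 'I_n.*2.+1) := sord n (e (sval k)).
have f_val k : sval (f k) = e (sval k) by rewrite sordK ?e_le ?sval_le.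
have f_inj : injective f.
  move=> j k /(congr1 (@Defs.sval n)); rewrite !f_val => /e_inj jk.
  by apply: sval_inj; apply: jk; exact: sval_le.
exists (perm f_inj).
  rewrite inE; apply/forallP => k; apply/eqP/sval_inj.
  by rewrite sval_rev !permE !f_val sval_rev eN.
apply: (@eq_from_nth _ 0); first by rewrite size_map size_iota.
move=> i; rewrite size_map size_iota => lt_in.
rewrite (nth_map 0%N) ?size_iota // nth_iota // sapp_sord permE f_val sordK; last by lia.
by rewrite /e /= mul1r.
Qed.

(** * Summation over rearrangement classes *)

Lemma sum_permutations_qt_weight n v : perm_eq [seq `|x|%N | x <- v] (iota 1 n) ->
  \sum_(u <- permutations v)
     qt_weight u (denH [seq `|x|%N | x <- u]) (exc [seq `|x|%N | x <- u])
  = \sum_(u <- permutations v) qt_weight u (maj u) (des u).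
Proof.
move=> vP; pose h := qt_weight v.
have uabs : uniq [seq `|x|%N | x <- v] by rewrite (perm_uniq vP) iota_uniq.
have uv := map_uniq uabs.
have szv : size v = n by rewrite -(size_map absz) (perm_size vP) size_iota.
have -> : \sum_(u <- permutations v) qt_weight u (maj u) (des u)
        = \sum_(u <- permutations v) h (maj u) (des u).
  by apply: eq_big_seq => u; rewrite mem_permutations => /perm_qt_weight ->.
transitivity (\sum_(w <- permutations (iota 1 n)) h (denH w) (exc w)).
  rewrite -(perm_big _ (perm_permutations vP)).
  rewrite (perm_big _ (perm_permutations_map _ uv)) /=; last first.
    move=> x y xv yv xy; rewrite -(nth_index 0 xv) -(nth_index 0 yv).
    congr nth; apply/eqP; rewrite -(nth_uniq 0%N _ _ uabs) ?size_map ?index_mem //.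
    by rewrite !(nth_map 0) ?index_mem // !nth_index // xy.
  rewrite big_map; apply: eq_big_seq => u.
  by rewrite mem_permutations => /perm_qt_weight ->.
transitivity (\sum_(w <- permutations (iota 1 n))
    h (denfrom 1 [::] w) (count id (excmarks 1 w))).
  apply: eq_big_seq => w; rewrite mem_permutations => /denfrom_denH ->.
  by rewrite exc_excmarks.
rewrite denfrom_majfrom.
(* [g] sends a rank, counted from 1, to the letter of [v] of that rank. *)
pose r := sort <=%R v; pose g j := nth 0 r j.-1.
have szr : size r = n by rewrite size_sort.
have g_mono : {in iota 1 n &, {mono g : x y / (x < y)%N >-> x < y}}.
  move=> i j; rewrite !mem_iota => iP jP; rewrite /g.
  rewrite (lt_sorted_ltn_nth 0) ?inE ?szr ?sort_lt_sorted //; lia.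
have rE : r = [seq g j | j <- iota 1 n].
  by rewrite (iotaDl 1 0) -map_comp -{1}[r]take_size -(map_nth_iota0 0) // szr.
have vr : perm_eq v r by rewrite perm_sym perm_sort.
rewrite (perm_big _ (perm_permutations vr)) /= rE.
rewrite (perm_big _ (perm_permutations_map _ (iota_uniq 1 n))) /=; last first.
  move=> i j iP jP gij; case: (ltngtP i j) => // lt_ij.
    by have := g_mono _ _ iP jP; rewrite lt_ij gij ltxx.
  by have := g_mono _ _ jP iP; rewrite lt_ij gij ltxx.
rewrite big_map; apply: eq_big_seq => w; rewrite mem_permutations => wP.
have [|-> -> //] := @maj_des_map g w.
by move=> i j iw jw; apply: g_mono; rewrite -(perm_mem wP).
Qed.

(** [W] is a disjoint union of full rearrangement classes; the induction removes the class of one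
    word at a time. *)
Lemma eq_sum_perm_closed (T : eqType) (V : nmodType) (F G : seq T -> V) W :
    uniq W -> (forall u v, u \in W -> perm_eq v u -> v \in W) ->
    (forall v, v \in W ->
       \sum_(u <- permutations v) F u = \sum_(u <- permutations v) G u) ->
  \sum_(v <- W) F v = \sum_(v <- W) G v.
Proof.
elim: {W}_.+1 {-2}W (ltnSn (size W)) => // m IHm [|v W'] ltWm; first by rewrite !big_nil.
move: (v :: W') ltWm (mem_head v W') => W ltWm Wv uW closedW eqFG.
have splitW H : \sum_(u <- W) H u = \sum_(u <- permutations v) H u
     + \sum_(u <- [seq u <- W | ~~ perm_eq u v]) H u :> V.
  rewrite (bigID (perm_eq^~ v)) /= -big_filter -[X in _ + X]big_filter; congr (_ + _).
  apply: perm_big; apply: uniq_perm; rewrite ?filter_uniq ?permutations_uniq // => u.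
  by rewrite mem_filter mem_permutations andb_idr // => /closedW->.
rewrite !splitW eqFG //; congr (_ + _); apply: IHm.
- rewrite size_filter; apply: (@leq_trans (size W)) => //.
  rewrite -(count_predC (perm_eq^~ v) W) -[X in (X < _)%N]add0n ltn_add2r -has_count.
  by apply/hasP; exists v.
- exact: filter_uniq.
- move=> u w; rewrite !mem_filter => /andP[uNv uW'] wu.
  by rewrite (closedW _ _ uW' wu) (permPl wu) uNv.
by move=> u; rewrite mem_filter => /andP[_ /eqFG].
Qed.

Lemma D_window n s : (s \in D n)
  = (s \in B n) && ~~ odd (count (fun x => x < 0) (window s)).
Proof. by rewrite inE /window count_map. Qed.

Theorem theorem5p8 (n : nat) (n_ge1 : (1 <= n)%N) :
  \sum_(s in D n) qvar ^+ `|dden s|%N * tvar ^+ dexc s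
  = \sum_(s in D n) qvar ^+ `|dmaj s|%N * tvar ^+ ddes s.
Proof.
under eq_bigr do rewrite dden_window.
under [RHS]eq_bigr do rewrite dmaj_window.
rewrite -!big_enum /=.
pose F v := qt_weight v (denH [seq `|x|%N | x <- v]) (exc [seq `|x|%N | x <- v]).
pose G v := qt_weight v (maj v) (des v).
rewrite -(big_map (@window n) xpredT F) -(big_map (@window n) xpredT G).
have DB s : s \in D n -> s \in B n by rewrite D_window => /andP[].
apply: eq_sum_perm_closed.
- rewrite map_inj_in_uniq ?enum_uniq // => s t; rewrite !mem_enum => /DB sB /DB tB.
  exact: window_inj.
(* Rearranging a window keeps its absolute values a permutation of 1, ..., n and keeps the number of
   negative letters. *)
- move=> _ v /mapP[s + ->]; rewrite mem_enum D_window => /andP[sB s_even] vs.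
  have [|t tB tv] := @window_surj n v.
    exact: perm_trans (perm_map absz vs) (abs_window sB).
  apply/mapP; exists t; rewrite // mem_enum D_window tB tv.
  by rewrite (seq.permP vs).
move=> _ /mapP[s + ->]; rewrite mem_enum => /DB /abs_window.
exact: sum_permutations_qt_weight.
Qed.
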